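(* Let $(X,r)$ and $(Y,s)$ be finite (non-empty) non-degenerate set-theoretic solutions to the Yang--Baxter equation that are permutation isoclinic. Then $(X,r)$ is multipermutation if and only if $(Y,s)$ is multipermutation.
   Context: A set-theoretic solution to the Yang--Baxter equation is a pair $(X,r)$ with $X$ a set and $r\colon X\times X\to X\times X$ bijective with $(r\times\mathrm{id})(\mathrm{id}\times r)(r\times\mathrm{id})=(\mathrm{id}\times r)(r\times\mathrm{id})(\mathrm{id}\times r)$. Write $r(x,y)=(\sigma_x(y),\tau_y(x))$. It is finite if $X$ is finite, and non-degenerate if all $\sigma_x,\tau_x\colon X\to X$ are bijective. Retraction: let $x\sim y$ iff $\sigma_x=\sigma_y$ and $\tau_x=\tau_y$. Then $r$ induces a solution $\operatorname{Ret}(X,r)$ on $X/{\sim}$ by $([x],[y])\mapsto([\sigma_x(y)],[\tau_y(x)])$. Put $\operatorname{Ret}^1=\operatorname{Ret}$, $\operatorname{Ret}^k(X,r)=\operatorname{Ret}(\operatorname{Ret}^{k-1}(X,r))$ for $k\ge2$. $(X,r)$ is multipermutation if for some $m\geq 1$ the underlying set of $\operatorname{Ret}^m(X,r)$ has exactly one element. A skew brace is a triple $(A,+,\circ)$ where $(A,+)$ and $(A,\circ)$ are groups (neither assumed commutative) with $a\circ(b+c)=a\circ b-a+a\circ c$ for all $a,b,c\in A$. The two groups share the identity $0$. Put $\lambda_a(b)=-a+a\circ b$, $a*b=-a+a\circ b-b$, $[a,b]_+=a+b-a-b$. The annihilator is $\operatorname{Ann}(A)=\ker\lambda\cap Z(A,+)\cap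 Z(A,\circ)$, an ideal of $A$; $\overline{a}$ denotes the class of $a$ in $A/\operatorname{Ann}(A)$. The commutator $A'$ is the additive subgroup generated by all $[a,b]_+$ and all $a*b$, $a,b\in A$; it is an ideal of $A$. The values $[a,b]_+$ and $a*b$ depend only on the classes of $a,b$ modulo $\operatorname{Ann}(A)$. Skew braces $A$ and $B$ are isoclinic if there are skew brace isomorphisms $\xi\colon A/\operatorname{Ann}(A)\to B/\operatorname{Ann}(B)$ and $\theta\colon A'\to B'$ such that, whenever $a_1,a_2\in A$ and $b_1,b_2\in B$ satisfy $\xi(\overline{a_i})=\overline{b_i}$ for $i=1,2$, one has $\theta([a_1,a_2]_+)=[b_1,b_2]_+$ and $\theta(a_1*a_2)=b_1*b_2$. Permutation skew brace: the structure group $G(X,r)=\langle X: x\circ y=\sigma_x(y)\circ\tau_y(x)\rangle$ has a unique skew brace structure with multiplicative group $G(X,r)$ such that $\lambda_{\iota(x)}(\iota(y))=\iota(\sigma_x(y))$ for all $x,y\in X$, where $\iota\colon X\to G(X,r)$ is the canonical map. The permutation group $\mathcal{G}(X,r)$ (generated by the permutations $\sigma_x,\tau_x$) is the image of the group homomorphism $G(X,r)\to\operatorname{Sym}(X)\times\operatorname{Sym}(X)$, $x\mapsto(\sigma_x,\tau_x^{-1})$; the kernel of this homomorphism is an ideal of the skew brace $G(X,r)$, and $\mathcal{G}(X,r)$ carries the quotient skew brace structure. Two solutions $(X,r)$, $(Y,s)$ are permutation isoclinic if the skew braces $\mathcal{G}(X,r)$ and $\mathcal{G}(Y,s)$ are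 isoclinic. *)

(* Defs.v *)
From HB Require Import structures.
From mathcomp Require Import all_boot perm.
From mathcomp Require Import boolp.

Set Implicit Arguments.
Unset Strict Implicit.
Unset Printing Implicit Defensive.

Local Open Scope group_scope.
Local Open Scope quotient_scope.

Definition braid12 (X : Type) (r : X * X -> X * X) (t : X * X * X) : X * X * X :=
  let: (x, y, z) := t in ((r (x, y)).1, (r (x, y)).2, z).

Definition braid23 (X : Type) (r : X * X -> X * X) (t : X * X * X) : X * X * X :=
  let: (x, y, z) := t in (x, (r (y, z)).1, (r (y, z)).2).

Definition yang_baxter (X : Type) (r : X * X -> X * X) : Prop :=
  forall t, braid12 r (braid23 r (braid12 r t))
          = braid23 r (braid12 r (braid23 r t)).

(* r (x, y) = (sigma_of r x y, tau_of r y x): the subscript comes first. *)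
Definition sigma_of (X : Type) (r : X * X -> X * X) (x y : X) : X := (r (x, y)).1.
Definition tau_of (X : Type) (r : X * X -> X * X) (y x : X) : X := (r (x, y)).2.

Record nd_solution := NdSolution {
  sol_set :> finType;
  sol_map : sol_set * sol_set -> sol_set * sol_set;
  sol_bij : bijective sol_map;
  sol_ybe : yang_baxter sol_map;
  sol_sigma_bij : forall x, bijective (sigma_of sol_map x);
  sol_tau_bij : forall y, bijective (tau_of sol_map y) }.

Lemma surj_bij (T : finType) (f : T -> T) :
  (forall y, exists x, f x = y) -> bijective f.
Proof.
move=> fs; have [g gK] := choice fs.
have [h hK gK2] := injF_bij (can_inj gK).
by exists g => // x; rewrite -{1}(gK2 x) gK.
Qed.

Section Solution.
Variable S : nd_solution.
Implicit Types x y z : S.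

Definition sigma x y : S := sigma_of (@sol_map S) x y.
Definition tau y x : S := tau_of (@sol_map S) y x.

Lemma sol_mapE x y : sol_map (x, y) = (sigma x y, tau y x).
Proof. by rewrite /sigma /tau /sigma_of /tau_of; case: (sol_map _). Qed.

Lemma sigma_inj x : injective (sigma x).
Proof. exact: bij_inj (sol_sigma_bij x). Qed.

Lemma tau_inj x : injective (tau x).
Proof. exact: bij_inj (sol_tau_bij x). Qed.

Lemma sigma_braid x y z :
  sigma (sigma x y) (sigma (tau y x) z) = sigma x (sigma y z).
Proof. by have [] := sol_ybe (x, y, z). Qed.

Lemma sigma_tau_braid x y z :
  tau (sigma (tau y x) z) (sigma x y) = sigma (tau (sigma y z) x) (tau z y).
Proof. by have [] := sol_ybe (x, y, z). Qed.

Lemma tau_braid x y z : tau z (tau y x) = tau (tau z y) (tau (sigma y z) x).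
Proof. by have [] := sol_ybe (x, y, z). Qed.

Definition ret_rel x y : bool :=
  [forall z, (sigma x z == sigma y z) && (tau x z == tau y z)].

Lemma ret_relP x y :
  reflect (sigma x =1 sigma y /\ tau x =1 tau y) (ret_rel x y).
Proof.
apply: (iffP forallP) => [h|[h1 h2] z]; last by rewrite h1 h2 !eqxx.
by split=> z; have /andP[/eqP ? /eqP ?] := h z.
Qed.

Lemma ret_rel_refl : reflexive ret_rel.
Proof. by move=> x; apply/ret_relP. Qed.

Lemma ret_rel_sym : symmetric ret_rel.
Proof.
by move=> x y; apply/ret_relP/ret_relP=> -[h1 h2]; split=> z; rewrite ?h1 ?h2.
Qed.

Lemma ret_rel_trans : transitive ret_rel.
Proof.
move=> y x z /ret_relP[h1 h2] /ret_relP[h3 h4]; apply/ret_relP.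
by split=> t; rewrite ?h1 ?h2.
Qed.

Definition ret_equiv := EquivRel ret_rel ret_rel_refl ret_rel_sym ret_rel_trans.

Definition ret_set := {eq_quot ret_equiv}.
HB.instance Definition _ := EqQuotient.on ret_set.
HB.instance Definition _ := Choice.on ret_set.
HB.instance Definition _ :=
  Countable.copy ret_set (can_type (@reprK _ ret_set)).
HB.instance Definition _ : isFinite ret_set := CanIsFinite (@reprK _ ret_set).

(* Computed on representatives; ret_map_pi shows the choice is irrelevant. *)
Definition ret_map (p : ret_set * ret_set) : ret_set * ret_set :=
  (\pi_ret_set (sigma (repr p.1) (repr p.2)),
   \pi_ret_set (tau (repr p.2) (repr p.1))).

Lemma pi_retP x y :
  reflect (sigma x =1 sigma y /\ tau x =1 tau y) (\pi_ret_set x == \pi_ret_set y).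
Proof. by rewrite eqmodE; apply: ret_relP. Qed.

Lemma repr_ret x :
  sigma (repr (\pi_ret_set x)) =1 sigma x /\ tau (repr (\pi_ret_set x)) =1 tau x.
Proof. by apply/pi_retP; rewrite reprK. Qed.

Lemma pi_sigma x x' y y' : \pi_ret_set x = \pi_ret_set x' ->
  \pi_ret_set y = \pi_ret_set y' ->
  \pi_ret_set (sigma x y) = \pi_ret_set (sigma x' y').
Proof.
move=> /eqP/pi_retP[sx _] /eqP/pi_retP[sy ty]; apply/eqP/pi_retP.
rewrite -sx; have surj w u : exists z, u = sigma w z.
  by have [g _ gK] := sol_sigma_bij w; exists (g u).
split=> u.
  have [z ->] := surj (tau y x) u.
  by rewrite sigma_braid [in RHS]ty sigma_braid sy.
by apply: (@tau_inj (tau y x)); rewrite -tau_braid [in RHS]ty -tau_braid ty.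
Qed.

Lemma pi_tau x x' y y' : \pi_ret_set x = \pi_ret_set x' ->
  \pi_ret_set y = \pi_ret_set y' ->
  \pi_ret_set (tau y x) = \pi_ret_set (tau y' x').
Proof.
move=> /eqP/pi_retP[sx tx] /eqP/pi_retP[_ ty]; rewrite -ty; apply/eqP/pi_retP.
have surjt w u : exists z, u = tau w z.
  by have [g _ gK] := sol_tau_bij w; exists (g u).
split=> u.
  by apply: (@sigma_inj (sigma x y)); rewrite [in RHS]sx !sigma_braid sx.
have [z ->] := surjt (sigma x y) u.
by rewrite [in RHS]sx -!tau_braid tx.
Qed.

Lemma ret_map_pi x y : ret_map (\pi_ret_set x, \pi_ret_set y)
  = (\pi_ret_set (sigma x y), \pi_ret_set (tau y x)).
Proof.
by rewrite /ret_map /=; congr pair; [apply: pi_sigma|apply: pi_tau]; rewrite reprK.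
Qed.

Lemma ret_pi (q : ret_set) : exists x, q = \pi_ret_set x.
Proof. by exists (repr q); rewrite reprK. Qed.

Lemma ret_bij : bijective ret_map.
Proof.
apply: (@surj_bij (ret_set * ret_set)%type) => -[p q]; have [x ->] := ret_pi p; have [y ->] := ret_pi q.
have [g _ gK] := sol_bij S; case E : (g (x, y)) => [a b].
exists (\pi_ret_set a, \pi_ret_set b); rewrite ret_map_pi.
by have := gK (x, y); rewrite E sol_mapE => -[-> ->].
Qed.

Lemma ret_ybe : yang_baxter ret_map.
Proof.
move=> [[p q] t]; have [x ->] := ret_pi p; have [y ->] := ret_pi q.
have [z ->] := ret_pi t.
have b12 a b c : braid12 ret_map (\pi_ret_set a, \pi_ret_set b, \pi_ret_set c)
    = (\pi_ret_set (sigma a b), \pi_ret_set (tau b a), \pi_ret_set c).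
  by rewrite /braid12 ret_map_pi.
have b23 a b c : braid23 ret_map (\pi_ret_set a, \pi_ret_set b, \pi_ret_set c)
    = (\pi_ret_set a, \pi_ret_set (sigma b c), \pi_ret_set (tau c b)).
  by rewrite /braid23 ret_map_pi.
move: ret_map b12 b23 => R b12 b23.
by rewrite !(b12, b23) sigma_braid sigma_tau_braid -tau_braid.
Qed.

Lemma ret_sigma_bij p : bijective (sigma_of ret_map p).
Proof.
apply: surj_bij => q; have [x ->] := ret_pi p; have [y ->] := ret_pi q.
have [g _ gK] := sol_sigma_bij x; exists (\pi_ret_set (g y)).
by rewrite /sigma_of ret_map_pi /= /sigma gK.
Qed.

Lemma ret_tau_bij p : bijective (tau_of ret_map p).
Proof.
apply: surj_bij => q; have [x ->] := ret_pi p; have [y ->] := ret_pi q.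
have [g _ gK] := sol_tau_bij x; exists (\pi_ret_set (g y)).
by rewrite /tau_of ret_map_pi /= /tau gK.
Qed.

Definition retraction : nd_solution :=
  NdSolution ret_bij ret_ybe ret_sigma_bij ret_tau_bij.

End Solution.

Definition multipermutation (S : nd_solution) : Prop :=
  exists2 m : nat, 0 < m & #|iter m retraction S| = 1%N.

(* A skew brace structure whose multiplicative group (A, o) is G. *)
Record skew_brace (G : groupType) := SkewBrace {
  sb_add : G -> G -> G;
  sb_zero : G;
  sb_opp : G -> G;
  sb_addA : associative sb_add;
  sb_add0l : left_id sb_zero sb_add;
  sb_add0r : right_id sb_zero sb_add;
  sb_addNl : left_inverse sb_zero sb_opp sb_add;
  sb_addNr : right_inverse sb_zero sb_opp sb_add;
  sb_mulD : forall a b c : G,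
    a * sb_add b c = sb_add (sb_add (a * b) (sb_opp a)) (a * c) }.

Section SkewBraceTheory.
Variables (G : groupType) (A : skew_brace G).
Implicit Types a b c : G.

Local Notation "a + b" := (sb_add A a b).
Local Notation "- a" := (sb_opp A a).
Local Notation "a - b" := (sb_add A a (sb_opp A b)).
Local Notation "0" := (sb_zero A).

Definition sb_lambda a b : G := - a + a * b.
Definition sb_star a b : G := - a + a * b - b.
Definition sb_comm a b : G := a + b - a - b.

Lemma sb_addK a b : a - b + b = a.
Proof. by rewrite -sb_addA sb_addNl sb_add0r. Qed.
Lemma sb_subK a b : a + b - b = a.
Proof. by rewrite -sb_addA sb_addNr sb_add0r. Qed.
Lemma sb_KD a b : - a + (a + b) = b.
Proof. by rewrite sb_addA sb_addNl sb_add0l. Qed.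
Lemma sb_KN a b : a + (- a + b) = b.
Proof. by rewrite sb_addA sb_addNr sb_add0l. Qed.
Lemma sb_addI a b c : a + b = a + c -> b = c.
Proof. by move=> h; rewrite -(sb_KD a b) h sb_KD. Qed.
Lemma sb_oppK a : - - a = a.
Proof. by apply: (@sb_addI (- a)); rewrite sb_addNr sb_addNl. Qed.
Lemma sb_oppD a b : - (a + b) = - b - a.
Proof. by apply: (@sb_addI (a + b)); rewrite sb_addNr sb_addA sb_subK sb_addNr. Qed.

Lemma sb_zero1 : 0 = 1.
Proof.
apply: (mulgI (1 : G)); apply/esym.
have := sb_mulD A 1 0 0; rewrite sb_add0l !mul1g.
by rewrite sb_add0l sb_add0r => h; rewrite -[LHS]sb_oppK -h -{1}(sb_add0l A (- 0)) sb_addNr.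
Qed.

Lemma sb_mulE a b : a * b = a + sb_lambda a b.
Proof. by rewrite /sb_lambda sb_KN. Qed.

Lemma sb_lambdaD a b c : sb_lambda a (b + c) = sb_lambda a b + sb_lambda a c.
Proof. by rewrite /sb_lambda sb_mulD !sb_addA. Qed.

Lemma sb_lambda0 a : sb_lambda a 0 = 0.
Proof. by rewrite /sb_lambda sb_zero1 mulg1 sb_addNl sb_zero1. Qed.

Lemma sb_lambdaN a b : sb_lambda a (- b) = - sb_lambda a b.
Proof.
by apply: (@sb_addI (sb_lambda a b)); rewrite -sb_lambdaD !sb_addNr sb_lambda0.
Qed.

Lemma sb_lambdaM a b c : sb_lambda (a * b) c = sb_lambda a (sb_lambda b c).
Proof.
rewrite {3}/sb_lambda sb_lambdaD sb_lambdaN {1 3}/sb_lambda -mulgA.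
by rewrite /sb_lambda sb_oppD sb_oppK -!sb_addA sb_KN.
Qed.

Lemma sb_lambda1 c : sb_lambda 1 c = c.
Proof. by rewrite /sb_lambda mul1g -sb_zero1 -{1}(sb_add0l A (- 0)) sb_addNr sb_add0l. Qed.

Lemma sb_lambdaE a b : sb_lambda a b = sb_star a b + b.
Proof. by rewrite /sb_star sb_addK. Qed.

Record is_ideal (I : G -> Prop) : Prop := IsIdeal {
  ideal0 : I 0;
  idealB : forall a b, I a -> I b -> I (a - b);
  ideal_lambda : forall a b, I b -> I (sb_lambda a b);
  ideal_conj_add : forall a b, I b -> I (a + b - a);
  ideal_conj_mul : forall a b, I b -> I (a * b * a^-1) }.

End SkewBraceTheory.

Section Quotient.
Variables (G : groupType) (A : skew_brace G) (I : G -> Prop) (HI : is_ideal A I).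
Implicit Types a b c : G.

Local Notation "a + b" := (sb_add A a b).
Local Notation "- a" := (sb_opp A a).
Local Notation "a - b" := (sb_add A a (sb_opp A b)).
Local Notation "0" := (sb_zero A).

Lemma idealN a : I a -> I (- a).
Proof. by move=> Ia; rewrite -(sb_add0l A (- a)); apply: (idealB HI) => //; apply: ideal0 HI. Qed.

Lemma idealD a b : I a -> I b -> I (a + b).
Proof. by move=> Ia Ib; rewrite -(sb_oppK A b); apply: (idealB HI) => //; apply: idealN. Qed.

Lemma idealM a b : I a -> I b -> I (a * b).
Proof. by move=> Ia Ib; rewrite (sb_mulE A); apply: idealD => //; apply: (ideal_lambda HI). Qed.

Lemma idealV a : I a -> I a^-1.
Proof.
move=> Ia; suff -> : a^-1 = - sb_lambda A a^-1 a.
  by apply/idealN/(ideal_lambda HI).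
by rewrite /sb_lambda mulVg -(sb_zero1 A) sb_add0r sb_oppK.
Qed.

Definition coset_rel a b : bool := `[< I (- a + b) >].

Lemma coset_rel_refl : reflexive coset_rel.
Proof. by move=> a; apply/asboolP; rewrite sb_addNl; apply: ideal0 HI. Qed.

Lemma coset_rel_sym : symmetric coset_rel.
Proof.
by move=> a b; apply/asboolP/asboolP => /idealN; rewrite sb_oppD sb_oppK.
Qed.

Lemma coset_rel_trans : transitive coset_rel.
Proof.
move=> b a c /asboolP h1 /asboolP h2; apply/asboolP.
by have := idealD h1 h2; rewrite -sb_addA sb_KN.
Qed.

Definition coset_equiv :=
  EquivRel coset_rel coset_rel_refl coset_rel_sym coset_rel_trans.

Definition quot_group := {eq_quot coset_equiv}.
HB.instance Definition _ := EqQuotient.on quot_group.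
HB.instance Definition _ := Choice.on quot_group.

Definition quot_pi a : quot_group := \pi_quot_group a.

Lemma quot_piP a b : quot_pi a = quot_pi b <-> I (- a + b).
Proof.
split=> [/eqP|h]; first by rewrite eqmodE => /asboolP.
by apply/eqP; rewrite eqmodE; apply/asboolP.
Qed.

Lemma quot_piE (q : quot_group) : quot_pi (repr q) = q.
Proof. exact: reprK. Qed.

Lemma quot_pi_mulP a b : quot_pi a = quot_pi b <-> exists2 i, I i & b = a * i.
Proof.
rewrite quot_piP; split=> [h|[i Ii ->]]; last exact: (ideal_lambda HI).
exists (sb_lambda A a^-1 (- a + b)); first exact: (ideal_lambda HI).
by rewrite (sb_mulE A) -sb_lambdaM mulgV sb_lambda1 sb_KN.
Qed.

Lemma quot_pi_mul a a' b b' : quot_pi a = quot_pi a' -> quot_pi b = quot_pi b' ->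
  quot_pi (a * b) = quot_pi (a' * b').
Proof.
move=> /quot_pi_mulP[i Ii ->] /quot_pi_mulP[j Ij ->]; apply/quot_pi_mulP.
exists (b^-1 * i * b * j); last by rewrite !mulgA mulgK.
by apply: idealM => //; rewrite -{2}(invgK b); apply: (ideal_conj_mul HI).
Qed.

Lemma quot_pi_inv a a' : quot_pi a = quot_pi a' -> quot_pi a^-1 = quot_pi a'^-1.
Proof.
move=> /quot_pi_mulP[i Ii ->]; apply/quot_pi_mulP; exists (a * i^-1 * a^-1).
  exact/(ideal_conj_mul HI)/idealV.
by rewrite invgM !mulgA mulVg mul1g.
Qed.

Lemma quot_pi_add a a' b b' : quot_pi a = quot_pi a' -> quot_pi b = quot_pi b' ->
  quot_pi (a + b) = quot_pi (a' + b').
Proof.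
move=> /quot_piP h1 /quot_piP h2; apply/quot_piP.
rewrite sb_oppD.
have -> : - b - a + (a' + b') = (- b + (- a + a') + b) + (- b + b').
  by rewrite -!sb_addA sb_KN.
by apply: idealD => //; rewrite -{2}(sb_oppK A b); apply: (ideal_conj_add HI).
Qed.

Lemma quot_pi_opp a a' : quot_pi a = quot_pi a' -> quot_pi (- a) = quot_pi (- a').
Proof.
move=> /quot_piP h; apply/quot_piP; rewrite sb_oppK.
have -> : a - a' = a + (- (- a + a')) - a by rewrite sb_oppD sb_oppK sb_addA sb_subK.
exact/(ideal_conj_add HI)/idealN.
Qed.

Definition quot_mul (p q : quot_group) := quot_pi (repr p * repr q).
Definition quot_one := quot_pi 1.
Definition quot_inv (p : quot_group) := quot_pi (repr p)^-1.
Definition quot_add (p q : quot_group) := quot_pi (repr p + repr q).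
Definition quot_zero := quot_pi 0.
Definition quot_opp (p : quot_group) := quot_pi (- repr p).

Lemma quot_mul_pi a b : quot_mul (quot_pi a) (quot_pi b) = quot_pi (a * b).
Proof. by apply: quot_pi_mul; rewrite quot_piE. Qed.
Lemma quot_inv_pi a : quot_inv (quot_pi a) = quot_pi a^-1.
Proof. by apply: quot_pi_inv; rewrite quot_piE. Qed.
Lemma quot_add_pi a b : quot_add (quot_pi a) (quot_pi b) = quot_pi (a + b).
Proof. by apply: quot_pi_add; rewrite quot_piE. Qed.
Lemma quot_opp_pi a : quot_opp (quot_pi a) = quot_pi (- a).
Proof. by apply: quot_pi_opp; rewrite quot_piE. Qed.

Lemma quot_mulA : associative quot_mul.
Proof.
by move=> p q t; rewrite -(quot_piE p) -(quot_piE q) -(quot_piE t) !quot_mul_pi mulgA.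
Qed.
Lemma quot_mul1l : left_id quot_one quot_mul.
Proof. by move=> p; rewrite -(quot_piE p) quot_mul_pi mul1g. Qed.
Lemma quot_mul1r : right_id quot_one quot_mul.
Proof. by move=> p; rewrite -(quot_piE p) quot_mul_pi mulg1. Qed.
Lemma quot_mulVl : left_inverse quot_one quot_inv quot_mul.
Proof. by move=> p; rewrite -(quot_piE p) quot_inv_pi quot_mul_pi mulVg. Qed.
Lemma quot_mulVr : right_inverse quot_one quot_inv quot_mul.
Proof. by move=> p; rewrite -(quot_piE p) quot_inv_pi quot_mul_pi mulgV. Qed.

HB.instance Definition _ := isGroup.Build quot_group
  quot_mulA quot_mul1l quot_mul1r quot_mulVl quot_mulVr.

Lemma quot_addA : associative quot_add.
Proof.
by move=> p q t; rewrite -(quot_piE p) -(quot_piE q) -(quot_piE t) !quot_add_pi sb_addA.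
Qed.
Lemma quot_add0l : left_id quot_zero quot_add.
Proof. by move=> p; rewrite -(quot_piE p) quot_add_pi sb_add0l. Qed.
Lemma quot_add0r : right_id quot_zero quot_add.
Proof. by move=> p; rewrite -(quot_piE p) quot_add_pi sb_add0r. Qed.
Lemma quot_addNl : left_inverse quot_zero quot_opp quot_add.
Proof. by move=> p; rewrite -(quot_piE p) quot_opp_pi quot_add_pi sb_addNl. Qed.
Lemma quot_addNr : right_inverse quot_zero quot_opp quot_add.
Proof. by move=> p; rewrite -(quot_piE p) quot_opp_pi quot_add_pi sb_addNr. Qed.
Lemma quot_mulD (a b c : quot_group) :
  a * quot_add b c = quot_add (quot_add (a * b) (quot_opp a)) (a * c).
Proof.
rewrite /mul /= -(quot_piE a) -(quot_piE b) -(quot_piE c).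
by rewrite !(quot_opp_pi, quot_add_pi, quot_mul_pi) sb_mulD.
Qed.

Definition quot_brace : skew_brace quot_group :=
  SkewBrace quot_addA quot_add0l quot_add0r quot_addNl quot_addNr quot_mulD.

End Quotient.

Section AnnDer.
Variables (G : groupType) (A : skew_brace G).
Implicit Types a b c : G.

Local Notation "a + b" := (sb_add A a b).
Local Notation "- a" := (sb_opp A a).
Local Notation "a - b" := (sb_add A a (sb_opp A b)).
Local Notation "0" := (sb_zero A).

Definition ann a : Prop :=
  [/\ forall b, sb_lambda A a b = b,
      forall b, a + b = b + a
    & forall b, a * b = b * a].

Lemma ann_ideal : is_ideal A ann.
Proof.
have ann_lam a b : ann b -> sb_lambda A a b = b.
  by move=> [l1 l2 l3]; rewrite /sb_lambda -l3 (sb_mulE A) l1 l2 sb_KD.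
have ann_mul a b : ann a -> a * b = a + b by move=> [l _ _]; rewrite (sb_mulE A) l.
split.
- by split=> b; rewrite ?sb_add0l ?sb_add0r // sb_zero1 ?sb_lambda1 // mul1g mulg1.
- move=> a b ha hb; have [a1 a2 a3] := ha; have [b1 b2 b3] := hb.
  have bV : b^-1 = - b.
    by apply: (mulgI b); rewrite mulgV ann_mul // sb_addNr sb_zero1.
  have -> : a - b = a * b^-1 by rewrite ann_mul // bV.
  split=> c.
  + by rewrite sb_lambdaM a1 -{1}(b1 c) -sb_lambdaM mulVg sb_lambda1.
  + rewrite ann_mul // bV -sb_addA.
    suff -> : - b + c = c - b by rewrite !sb_addA a2.
    by apply: (@sb_addI _ A b); rewrite sb_KN sb_addA b2 sb_subK.
  + rewrite -mulgA; suff -> : b^-1 * c = c * b^-1 by rewrite !mulgA a3.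
    by apply: (mulgI b); rewrite mulVKg mulgA b3 mulgK.
- by move=> a b hb; rewrite ann_lam.
- by move=> a b hb; have [_ h _] := hb; rewrite -h sb_subK.
- by move=> a b hb; have [_ _ h] := hb; rewrite -h mulgK.
Qed.

Definition ann_quot : groupType := quot_group ann_ideal.
Definition ann_quot_brace : skew_brace ann_quot := quot_brace ann_ideal.
Definition ann_pi (a : G) : ann_quot := quot_pi ann_ideal a.

Inductive derived : G -> Prop :=
| derived_comm a b : derived (sb_comm A a b)
| derived_star a b : derived (sb_star A a b)
| derived_zero : derived 0
| derived_add a b : derived a -> derived b -> derived (a + b)
| derived_opp a : derived a -> derived (- a).

Definition derivedb : {pred G} := fun a => `[< derived a >].

Lemma derivedbP a : reflect (derived a) (a \in derivedb).
Proof. exact: asboolP. Qed.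

Lemma derived_lambda a b : derived b -> derived (sb_lambda A a b).
Proof.
by move=> h; rewrite sb_lambdaE; apply: derived_add => //; apply: derived_star.
Qed.

Lemma derived_group_closed : group_closed derivedb.
Proof.
split; first by apply/derivedbP; rewrite -(sb_zero1 A); apply: derived_zero.
move=> a b /derivedbP ha /derivedbP hb; apply/derivedbP.
rewrite (sb_mulE A); apply/derived_add/derived_lambda => //.
have -> : b^-1 = - sb_lambda A b^-1 b.
  by rewrite /sb_lambda mulVg -(sb_zero1 A) sb_add0r sb_oppK.
exact/derived_opp/derived_lambda.
Qed.

Record derived_group := DerivedElt {
  der_val :> G;
  der_valP : der_val \in derivedb }.

HB.instance Definition _ := [isSub for der_val].
HB.instance Definition _ := [Choice of derived_group by <:].
HB.instance Definition _ :=
  SubChoice_isSubGroup.Build G derivedb derived_group derived_group_closed.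

Implicit Types u v w : derived_group.

Definition mk_der a (h : derived a) : derived_group :=
  DerivedElt (introT (derivedbP a) h).

Definition der_add u v : derived_group :=
  mk_der (derived_add (elimT (derivedbP _) (der_valP u))
                      (elimT (derivedbP _) (der_valP v))).
Definition der_zero : derived_group := mk_der derived_zero.
Definition der_opp u : derived_group :=
  mk_der (derived_opp (elimT (derivedbP _) (der_valP u))).
Definition der_comm a b : derived_group := mk_der (derived_comm a b).
Definition der_star a b : derived_group := mk_der (derived_star a b).

Lemma der_addA : associative der_add.
Proof. by move=> u v w; apply: val_inj; rewrite /= sb_addA. Qed.
Lemma der_add0l : left_id der_zero der_add.
Proof. by move=> u; apply: val_inj; rewrite /= sb_add0l. Qed.
Lemma der_add0r : right_id der_zero der_add.
Proof. by move=> u; apply: val_inj; rewrite /= sb_add0r. Qed.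
Lemma der_addNl : left_inverse der_zero der_opp der_add.
Proof. by move=> u; apply: val_inj; rewrite /= sb_addNl. Qed.
Lemma der_addNr : right_inverse der_zero der_opp der_add.
Proof. by move=> u; apply: val_inj; rewrite /= sb_addNr. Qed.
Lemma der_mulD u v w :
  u * der_add v w = der_add (der_add (u * v) (der_opp u)) (u * w).
Proof. by apply: val_inj; rewrite /= sb_mulD. Qed.

Definition derived_brace : skew_brace derived_group :=
  SkewBrace der_addA der_add0l der_add0r der_addNl der_addNr der_mulD.

End AnnDer.

Definition brace_iso (G H : groupType) (A : skew_brace G) (B : skew_brace H)
    (f : G -> H) : Prop :=
  [/\ bijective f,
      {morph f : a b / a * b}
    & {morph f : a b / sb_add A a b >-> sb_add B a b}].

Definition isoclinic (G H : groupType) (A : skew_brace G) (B : skew_brace H) :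
    Prop :=
  exists (xi : ann_quot A -> ann_quot B)
         (theta : derived_group A -> derived_group B),
    [/\ brace_iso (ann_quot_brace A) (ann_quot_brace B) xi,
        brace_iso (derived_brace A) (derived_brace B) theta
      & forall (a1 a2 : G) (b1 b2 : H),
          xi (ann_pi A a1) = ann_pi B b1 -> xi (ann_pi A a2) = ann_pi B b2 ->
          theta (der_comm A a1 a2) = der_comm B b1 b2 /\
          theta (der_star A a1 a2) = der_star B b1 b2].

(* The product of {perm X} composes from left to right; Sym X is the same set *)
(* with the usual composition of maps.                                        *)
Definition Sym (X : finType) := {perm X}.
HB.instance Definition _ (X : finType) := Choice.on (Sym X).

Section Sym.
Variable X : finType.
Definition sym_mul (s t : Sym X) : Sym X := (t * s :> {perm X}).
Definition sym_one : Sym X := (1 :> {perm X}).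
Definition sym_inv (s : Sym X) : Sym X := (s^-1 :> {perm X}).
Lemma sym_mulA : associative sym_mul.
Proof. by move=> s t u; rewrite /sym_mul mulgA. Qed.
Lemma sym_mul1l : left_id sym_one sym_mul. Proof. by move=> s; apply: mulg1. Qed.
Lemma sym_mul1r : right_id sym_one sym_mul. Proof. by move=> s; apply: mul1g. Qed.
Lemma sym_mulVl : left_inverse sym_one sym_inv sym_mul.
Proof. by move=> s; apply: mulgV. Qed.
Lemma sym_mulVr : right_inverse sym_one sym_inv sym_mul.
Proof. by move=> s; apply: mulVg. Qed.
HB.instance Definition _ := isGroup.Build (Sym X)
  sym_mulA sym_mul1l sym_mul1r sym_mulVl sym_mulVr.
End Sym.

Section StructureGroup.
Variable S : nd_solution.
Implicit Types x y z : S.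

(* Words in the letters x = (false, x) and x^-1 = (true, x). *)
Definition word := seq (bool * S).

Inductive word_eq : word -> word -> Prop :=
| weq_refl u : word_eq u u
| weq_sym u v : word_eq u v -> word_eq v u
| weq_trans u v w : word_eq u v -> word_eq v w -> word_eq u w
| weq_cat u u' v v' : word_eq u u' -> word_eq v v' -> word_eq (u ++ v) (u' ++ v')
| weq_cancel b x : word_eq [:: (b, x); (~~ b, x)] [::]
| weq_rel x y : word_eq [:: (false, x); (false, y)]
                        [:: (false, sigma x y); (false, tau y x)].

Definition word_eqb : rel word := fun u v => `[< word_eq u v >].

Lemma word_eqb_refl : reflexive word_eqb.
Proof. by move=> u; apply/asboolP/weq_refl. Qed.
Lemma word_eqb_sym : symmetric word_eqb.
Proof. by move=> u v; apply/asboolP/asboolP => /weq_sym. Qed.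
Lemma word_eqb_trans : transitive word_eqb.
Proof. by move=> v u w /asboolP h1 /asboolP h2; apply/asboolP/(weq_trans h1). Qed.

Definition word_equiv :=
  EquivRel word_eqb word_eqb_refl word_eqb_sym word_eqb_trans.

Definition structure_group := {eq_quot word_equiv}.
HB.instance Definition _ := EqQuotient.on structure_group.
HB.instance Definition _ := Choice.on structure_group.

Definition wpi (u : word) : structure_group := \pi_structure_group u.

Lemma wpiP u v : wpi u = wpi v <-> word_eq u v.
Proof.
split=> [/eqP|h]; first by rewrite eqmodE => /asboolP.
by apply/eqP; rewrite eqmodE; apply/asboolP.
Qed.

Lemma wpiE (g : structure_group) : wpi (repr g) = g.
Proof. exact: reprK. Qed.

Lemma repr_wpi u : word_eq (repr (wpi u)) u.
Proof. by apply/wpiP; rewrite wpiE. Qed.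

Definition word_inv (u : word) : word := rev [seq (~~ l.1, l.2) | l <- u].

Lemma word_inv_cat u v : word_inv (u ++ v) = word_inv v ++ word_inv u.
Proof. by rewrite /word_inv map_cat rev_cat. Qed.

Lemma word_invK : involutive word_inv.
Proof.
move=> u; rewrite /word_inv map_rev revK -map_comp map_id_in // => -[b x] _ /=.
by rewrite negbK.
Qed.

Lemma word_mulV u : word_eq (u ++ word_inv u) [::].
Proof.
elim: u => [|[b x] u IH]; first exact: weq_refl.
rewrite -cat1s word_inv_cat -catA (catA u).
apply: weq_trans (weq_cancel b x).
rewrite -[X in word_eq _ X]/([:: (b, x)] ++ ([::] ++ [:: (~~ b, x)])).
by apply/weq_cat/weq_cat => //; apply: weq_refl.
Qed.

Lemma word_Vmul u : word_eq (word_inv u ++ u) [::].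
Proof. by rewrite -{2}(word_invK u); apply: word_mulV. Qed.

Lemma word_eq_inv u v : word_eq u v -> word_eq (word_inv u) (word_inv v).
Proof.
move=> h; have h1 : word_eq (word_inv u) (word_inv u ++ (v ++ word_inv v)).
  rewrite -{1}[word_inv u]cats0; apply/weq_cat/weq_sym/word_mulV/weq_refl.
apply: weq_trans h1 _; rewrite catA -[X in word_eq _ X]cat0s.
apply: weq_cat (weq_refl _); apply: weq_trans (word_Vmul u).
by apply: weq_cat (weq_refl _) (weq_sym h).
Qed.

Definition sg_mul (g h : structure_group) := wpi (repr g ++ repr h).
Definition sg_one := wpi [::].
Definition sg_inv (g : structure_group) := wpi (word_inv (repr g)).

Lemma sg_mul_pi u v : sg_mul (wpi u) (wpi v) = wpi (u ++ v).
Proof. by apply/wpiP/weq_cat; apply: repr_wpi. Qed.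
Lemma sg_inv_pi u : sg_inv (wpi u) = wpi (word_inv u).
Proof. by apply/wpiP/word_eq_inv/repr_wpi. Qed.

Lemma sg_mulA : associative sg_mul.
Proof. by move=> g h k; rewrite -(wpiE g) -(wpiE h) -(wpiE k) !sg_mul_pi catA. Qed.
Lemma sg_mul1l : left_id sg_one sg_mul.
Proof. by move=> g; rewrite -(wpiE g) sg_mul_pi. Qed.
Lemma sg_mul1r : right_id sg_one sg_mul.
Proof. by move=> g; rewrite -(wpiE g) sg_mul_pi cats0. Qed.
Lemma sg_mulVl : left_inverse sg_one sg_inv sg_mul.
Proof. by move=> g; rewrite -(wpiE g) sg_inv_pi sg_mul_pi; apply/wpiP/word_Vmul. Qed.
Lemma sg_mulVr : right_inverse sg_one sg_inv sg_mul.
Proof. by move=> g; rewrite -(wpiE g) sg_inv_pi sg_mul_pi; apply/wpiP/word_mulV. Qed.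

HB.instance Definition _ := isGroup.Build structure_group
  sg_mulA sg_mul1l sg_mul1r sg_mulVl sg_mulVr.

Definition iota_sg x : structure_group := wpi [:: (false, x)].

Lemma iota_sgM x y :
  iota_sg x * iota_sg y = iota_sg (sigma x y) * iota_sg (tau y x).
Proof. by rewrite /mul /= !sg_mul_pi; apply/wpiP/weq_rel. Qed.

Section Lift.
Variables (H : groupType) (f : S -> H).

Definition word_eval (u : word) : H :=
  foldr (fun l h => (if l.1 then (f l.2)^-1 else f l.2) * h) 1 u.

Definition sg_lift (g : structure_group) : H := word_eval (repr g).

Hypothesis f_rel : forall x y, f x * f y = f (sigma x y) * f (tau y x).

Lemma word_eval_cat u v : word_eval (u ++ v) = word_eval u * word_eval v.
Proof. by elim: u => [|l u IH] /=; rewrite ?mul1g // IH mulgA. Qed.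

Lemma word_eval_eq u v : word_eq u v -> word_eval u = word_eval v.
Proof.
elim=> {u v} //.
- by move=> u v w _ -> _ ->.
- by move=> u u' v v' _ h1 _ h2; rewrite !word_eval_cat h1 h2.
- by move=> [] x /=; rewrite mulg1 ?mulVg ?mulgV.
- by move=> x y /=; rewrite !mulg1.
Qed.

Lemma sg_lift_pi u : sg_lift (wpi u) = word_eval u.
Proof. exact/word_eval_eq/repr_wpi. Qed.

Lemma sg_liftM : {morph sg_lift : g h / g * h}.
Proof.
by move=> g h; rewrite -(wpiE g) -(wpiE h) /mul /= sg_mul_pi !sg_lift_pi word_eval_cat.
Qed.

Lemma sg_lift_iota x : sg_lift (iota_sg x) = f x.
Proof. by rewrite sg_lift_pi /= mulg1. Qed.
End Lift.

Definition sigma_sym x : Sym S := perm (@sigma_inj S x).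
Definition tau_sym x : Sym S := perm (@tau_inj S x).

Definition perm_gen x : Sym S * Sym S := (sigma_sym x, (tau_sym x)^-1).

Lemma perm_gen_rel x y :
  perm_gen x * perm_gen y = perm_gen (sigma x y) * perm_gen (tau y x).
Proof.
congr pair; first by apply/permP => z; rewrite /= !permM !permE sigma_braid.
rewrite /= -!invgM; congr (_^-1).
by apply/permP => z; rewrite /= !permM !permE -tau_braid.
Qed.

Definition perm_hom : structure_group -> Sym S * Sym S := sg_lift perm_gen.

Lemma perm_homM : {morph perm_hom : g h / g * h}.
Proof. exact: sg_liftM perm_gen_rel. Qed.

Lemma perm_hom_iota x : perm_hom (iota_sg x) = (sigma_sym x, (tau_sym x)^-1).
Proof. exact: (sg_lift_iota perm_gen_rel). Qed.

Definition perm_image : {pred Sym S * Sym S} :=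
  fun p => `[< exists g, perm_hom g = p >].

Lemma perm_image_closed : group_closed perm_image.
Proof.
have h1 : perm_hom 1 = 1.
  by apply: (mulgI (perm_hom 1)); rewrite -perm_homM !mulg1.
split; first by apply/asboolP; exists 1.
move=> _ _ /asboolP[g <-] /asboolP[h <-]; apply/asboolP; exists (g * h^-1).
rewrite perm_homM; congr (_ * _); apply: (mulgI (perm_hom h)).
by rewrite -perm_homM !mulgV.
Qed.

Record perm_group := PermGroupElt {
  pg_val :> Sym S * Sym S;
  pg_valP : pg_val \in perm_image }.

HB.instance Definition _ := [isSub for pg_val].
HB.instance Definition _ := [Choice of perm_group by <:].
HB.instance Definition _ := SubChoice_isSubGroup.Build
  (Sym S * Sym S)%type perm_image perm_group perm_image_closed.

Lemma perm_homP g : perm_hom g \in perm_image.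
Proof. by apply/asboolP; exists g. Qed.

Definition perm_proj (g : structure_group) : perm_group :=
  PermGroupElt (perm_homP g).

Lemma perm_projM : {morph perm_proj : g h / g * h}.
Proof. by move=> g h; apply: val_inj; apply: perm_homM. Qed.

Lemma perm_proj_surj (p : perm_group) : exists g, perm_proj g = p.
Proof. by have /asboolP[g gp] := pg_valP p; exists g; apply: val_inj. Qed.

Definition is_structure_brace (A : skew_brace structure_group) : Prop :=
  forall x y, sb_lambda A (iota_sg x) (iota_sg y) = iota_sg (sigma x y).

(* perm_proj is a surjective group homomorphism, so P is the quotient of A by *)
(* the kernel of perm_hom exactly when perm_proj is additive.                 *)
Definition is_permutation_brace (P : skew_brace perm_group) : Prop :=
  exists2 A : skew_brace structure_group, is_structure_brace A &
    {morph perm_proj : g h / sb_add A g h >-> sb_add P g h}.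

End StructureGroup.

Definition permutation_isoclinic (S T : nd_solution) : Prop :=
  exists (P : skew_brace (perm_group S)) (Q : skew_brace (perm_group T)),
    [/\ is_permutation_brace P, is_permutation_brace Q & isoclinic P Q].

(* Main.v *)
(* A skew brace A carries the solution (a, b) |-> (lambda_a b, rho_b a), and  *)
(* being multipermutation transfers along a morphism of solutions f: forwards *)
(* if f is surjective, backwards if f x = f y forces x and y to be identified *)
(* after finitely many retractions. Elements congruent modulo Ann(A) are      *)
(* identified by one retraction, so A is multipermutation iff A / Ann(A) is,  *)
(* and only the isomorphism between the annihilator quotients matters. It     *)
(* remains to see that X is multipermutation iff the brace G(X, r) is. The    *)
(* canonical map X -> G(X, r) identifies x and y iff Ret does, which gives    *)
(* one direction. For the other, if g and h act in the same way on Ret^n(X),  *)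
(* then induction on n and on words in the generators shows that they are     *)
(* identified in Ret^n(G(X, r)).                                              *)
Require Import Defs.
From mathcomp Require Import all_boot.
From mathcomp Require Import perm boolp.

Set Implicit Arguments.
Unset Strict Implicit.
Unset Printing Implicit Defensive.

Local Open Scope group_scope.
Local Open Scope quotient_scope.

(** Dividing a skew brace by its annihilator costs at most one retraction ([brace_mp_ann]), so
    [brace_mp] is an isoclinism invariant ([isoclinic_brace_mp]). The bridge to solutions is
    [permutation_brace_mp]. In one direction, points with the same [pgen] have the same sigma and
    tau. The other rests on [pact_eq_iret]: elements acting alike on Ret^n are identified after n
    retractions, because lambda and rho lower the level of agreement by only one ([pact_eq_lambda],
    [pact_eq_rho]). *)

(** * Iterated retraction as a relation *)

Section IteratedRetraction.
Variable X : Type.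
Variables s t : X -> X -> X.

(** Equality in the n-th retraction, unfolded on [X] itself. No quotient is formed, so the relation
    makes sense for any two operations on any type, in particular for those of a skew brace. The
    subscript is the first argument of [s] and [t]. *)
Fixpoint iret n x y : Prop :=
  if n is m.+1 then
    forall z, iret m (s x z) (s y z) /\ iret m (t x z) (t y z)
  else x = y.

Definition iret_trivial := exists n, forall x y, iret n x y.

Lemma iret_refl n x : iret n x x.
Proof. by elim: n x => //= n IH x z; split; apply: IH. Qed.

Lemma iret_sym n x y : iret n x y -> iret n y x.
Proof.
elim: n x y => //= n IH x y h z.
by have [/IH ? /IH ?] := h z.
Qed.

End IteratedRetraction.

Section Transfer.
Variables (X Y : Type) (s t : X -> X -> X) (s' t' : Y -> Y -> Y) (f : X -> Y).
Hypothesis fs : {morph f : x y / s x y >-> s' x y}.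
Hypothesis ft : {morph f : x y / t x y >-> t' x y}.

Lemma iret_trivial_surj : (forall y, exists x, f x = y) ->
  iret_trivial s t -> iret_trivial s' t'.
Proof.
move=> fsurj [n h]; exists n => x y.
have [a <-] := fsurj x; have [b <-] := fsurj y; move: (h a b) => {h}.
elim: n a b => [|n IH] a b /= h; first by rewrite h.
move=> z; have [c <-] := fsurj z; rewrite -!fs -!ft.
by have [/IH ? /IH ?] := h c.
Qed.

Lemma iret_trivial_ker k : (forall x y, f x = f y -> iret s t k x y) ->
  iret_trivial s' t' -> iret_trivial s t.
Proof.
(* After [n] rounds the images under [f] are equal; [k] further rounds then identify the elements of
   [X]. *)
move=> hk [n h]; exists (n + k)%N => x y; move: (h (f x) (f y)) => {h}.
elim: n x y => [|n IH] x y /= h; first exact: hk.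
by move=> z; have := h (f z); rewrite -!fs -!ft => -[/IH ? /IH ?].
Qed.

End Transfer.

(** * Comparison with the actual retractions of a solution *)

Section SolutionRetraction.
Variable S : nd_solution.

(** Exhibiting [iret n] as the kernel of a morphism makes it a congruence, which is awkward to see
    from the recursion. *)
Lemma iter_retraction_proj n : exists f : S -> iter n retraction S,
  [/\ {morph f : x y / sigma x y >-> sigma x y},
      {morph f : x y / tau x y >-> tau x y},
      forall q, exists x, f x = q
    & forall x y, f x = f y <-> iret (@sigma S) (@tau S) n x y].
Proof.
elim: n => [|n [f [fs ft fsurj fK]]].
  by exists id; split=> // q; exists q.
exists (fun x => \pi_(ret_set (iter n retraction S)) (f x)); split.
- by move=> x y; rewrite fs; have := congr1 fst (ret_map_pi (f x) (f y)).
- by move=> x y; rewrite ft; have := congr1 snd (ret_map_pi (f y) (f x)).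
- by move=> q; have [w ->] := ret_pi q; have [x <-] := fsurj w; exists x.
move=> x y; split=> [/eqP/pi_retP[h1 h2] z|h].
  by split; apply/fK; rewrite ?fs ?ft.
apply/eqP/pi_retP; split=> w; have [z <-] := fsurj w; have [h1 h2] := h z.
  by rewrite -!fs; apply/fK.
by rewrite -!ft; apply/fK.
Qed.

Lemma multipermutationP : (0 < #|S|)%N ->
  multipermutation S <-> iret_trivial (@sigma S) (@tau S).
Proof.
move=> /card_gt0P[x0 _]; split=> [[m _ /eqP/fintype1P[w hw]]|[n h]].
  have [f [_ _ _ fK]] := iter_retraction_proj m; exists m => x y.
  by apply/fK; rewrite (hw (f x)) (hw (f y)).
(* One extra retraction guarantees a positive exponent even when [n] is 0. *)
exists n.+1 => //; have [f [_ _ fsurj fK]] := iter_retraction_proj n.+1.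
apply/eqP/fintype1P; exists (f x0) => w; have [x <-] := fsurj w.
by apply/fK => z; split; apply: h.
Qed.

Lemma iret_congr n x x' y y' :
  iret (@sigma S) (@tau S) n x x' -> iret (@sigma S) (@tau S) n y y' ->
  iret (@sigma S) (@tau S) n (sigma x y) (sigma x' y') /\
  iret (@sigma S) (@tau S) n (tau x y) (tau x' y').
Proof.
have [f [fs ft _ fK]] := iter_retraction_proj n.
by move=> /fK hx /fK hy; split; apply/fK; rewrite ?fs ?ft hx hy.
Qed.

Lemma iret_trans n y x z :
  iret (@sigma S) (@tau S) n x y -> iret (@sigma S) (@tau S) n y z ->
  iret (@sigma S) (@tau S) n x z.
Proof.
have [f [_ _ _ fK]] := iter_retraction_proj n.
by move=> /fK h1 /fK h2; apply/fK; rewrite h1.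
Qed.

End SolutionRetraction.

(** * The solution of a skew brace and its morphisms *)

Section BraceSolution.
Variables (G : groupType) (A : skew_brace G).
Implicit Types a b c d g : G.

(* The solution attached to A is (a, b) |-> (lambda_a b, rho_b a); as with    *)
(* tau, the subscript is the first argument.                                  *)
Definition sb_rho b a : G := (sb_lambda A a b)^-1 * (a * b).

Lemma sb_lambda_rho a b : sb_lambda A a b * sb_rho b a = a * b.
Proof. by rewrite /sb_rho mulVKg. Qed.

(** Both sides equal lambda_a(c) + lambda_{a o c}(d), because a o c = lambda_a(c) o rho_c(a). *)
Lemma sb_lambda_mulr a c d :
  sb_lambda A a (c * d) = sb_lambda A a c * sb_lambda A (sb_rho c a) d.
Proof.
rewrite [RHS](sb_mulE A) -sb_lambdaM sb_lambda_rho /sb_lambda mulgA.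
by rewrite -sb_addA sb_KN.
Qed.

Lemma sb_rhoM g h c : sb_rho (g * h) c = sb_rho h (sb_rho g c).
Proof. by rewrite {1}/sb_rho sb_lambda_mulr invgM /sb_rho !mulgA. Qed.

Lemma sb_rho_mulr g c d :
  sb_rho g (c * d) = sb_rho (sb_lambda A d g) c * sb_rho g d.
Proof.
rewrite {1}/sb_rho sb_lambdaM -(mulgA c d) -(sb_lambda_rho d g).
by rewrite {2}/sb_rho !mulgA.
Qed.

Lemma sb_rho1 c : sb_rho 1 c = c.
Proof. by rewrite /sb_rho -{1}(sb_zero1 A) sb_lambda0 sb_zero1 invg1 mulg1 mul1g. Qed.

Definition brace_mp := iret_trivial (sb_lambda A) sb_rho.

End BraceSolution.

Section BraceMorphism.
Variables (G H : groupType) (A : skew_brace G) (B : skew_brace H) (f : G -> H).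
Hypothesis fM : {morph f : a b / a * b}.
Hypothesis fD : {morph f : a b / sb_add A a b >-> sb_add B a b}.

Lemma brace_morph_opp a : f (sb_opp A a) = sb_opp B (f a).
Proof.
apply: (@sb_addI _ B (f a)); rewrite -fD !sb_addNr.
by apply: (@sb_addI _ B (f (sb_zero A))); rewrite -fD sb_add0r sb_add0r.
Qed.

Lemma brace_morph_lambda : {morph f : a b / sb_lambda A a b >-> sb_lambda B a b}.
Proof. by move=> a b; rewrite /sb_lambda fD brace_morph_opp fM. Qed.

Lemma brace_morph_rho : {morph f : a b / sb_rho A a b >-> sb_rho B a b}.
Proof.
move=> a b; apply: (mulgI (f (sb_lambda A b a))).
by rewrite -fM sb_lambda_rho brace_morph_lambda sb_lambda_rho fM.
Qed.

Lemma brace_mp_surj : (forall b, exists a, f a = b) -> brace_mp A -> brace_mp B.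
Proof. exact: (iret_trivial_surj brace_morph_lambda brace_morph_rho). Qed.

Lemma brace_mp_ker k :
  (forall a b, f a = f b -> iret (sb_lambda A) (sb_rho A) k a b) ->
  brace_mp B -> brace_mp A.
Proof. exact: (iret_trivial_ker brace_morph_lambda brace_morph_rho). Qed.

End BraceMorphism.

Lemma brace_mp_iso (G H : groupType) (A : skew_brace G) (B : skew_brace H) f :
  brace_iso A B f -> brace_mp A <-> brace_mp B.
Proof.
move=> [[g fK gK] fM fD]; split.
  by apply: (brace_mp_surj fM fD) => b; exists (g b).
by apply: (@brace_mp_ker _ _ _ _ f fM fD 0) => a b /(can_inj fK).
Qed.

(** * Annihilator quotients and isoclinism *)

Section AnnQuotient.
Variables (G : groupType) (A : skew_brace G).

Lemma ann_piM : {morph ann_pi A : a b / a * b}.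
Proof. by move=> a b; rewrite {2}/mul /= quot_mul_pi. Qed.

Lemma ann_piD :
  {morph ann_pi A : a b / sb_add A a b >-> sb_add (ann_quot_brace A) a b}.
Proof. by move=> a b; rewrite /= quot_add_pi. Qed.

(** An annihilator factor [i] is central, acts trivially and is fixed by every lambda, so it cancels
    from both operations. *)
Lemma ann_pi_iret1 a b :
  ann_pi A a = ann_pi A b -> iret (sb_lambda A) (sb_rho A) 1 a b.
Proof.
move=> /quot_pi_mulP[i [il ia im] ->] c /=.
have lamV d : sb_lambda A d i = i.
  by rewrite /sb_lambda -im (sb_mulE A i) il ia sb_KD.
split; first by rewrite sb_lambdaM il.
have e : sb_lambda A c (a * i) = sb_lambda A c a * i.
  by rewrite !(sb_mulE A _ i) !lamV sb_lambdaD lamV.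
by rewrite /sb_rho e (mulgA c) -!im invgM -mulgA mulKg.
Qed.

Lemma brace_mp_ann : brace_mp A <-> brace_mp (ann_quot_brace A).
Proof.
split.
  apply: (brace_mp_surj ann_piM ann_piD) => q; exists (repr q).
  exact: quot_piE.
exact: (brace_mp_ker ann_piM ann_piD ann_pi_iret1).
Qed.

End AnnQuotient.

Lemma isoclinic_brace_mp (G H : groupType) (A : skew_brace G) (B : skew_brace H) :
  isoclinic A B -> brace_mp A <-> brace_mp B.
Proof.
move=> [xi [_ [/brace_mp_iso h _ _]]].
exact: (iff_trans (brace_mp_ann A) (iff_trans h (iff_sym (brace_mp_ann B)))).
Qed.

(** By pigeonhole two powers of [x] coincide. The injection [f] expresses finiteness, since a
    [groupType] carries no finite structure. *)
Lemma invg_expg (G : groupType) (T : finType) (f : G -> T) (x : G) :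
  injective f -> exists n, x^-1 = x ^+ n.
Proof.
move=> fI; pose F (i : 'I_#|T|.+1) := f (x ^+ i).
have : ~ injective F.
  by move=> /leq_card; rewrite card_ord ltnn.
move=> /injectiveP/injectivePn[i [j ij /fI e]].
wlog lij : i j ij e / (i < j)%N.
  move=> W; case: (ltngtP i j) => [h|h|/val_inj h].
  - exact: (W i j).
  - by apply: (W j i) => //; rewrite eq_sym.
  - by rewrite h eqxx in ij.
exists (j - i).-1; apply: (mulgI x); rewrite mulgV -expgS prednK ?subn_gt0 //.
by apply: (mulgI (x ^+ i)); rewrite mulg1 -expgnDr subnKC // ltnW.
Qed.

(** * The permutation brace and its actions *)

Section PermutationBrace.
Variables (S : nd_solution) (P : skew_brace (perm_group S)).
Hypothesis HP : is_permutation_brace P.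
Implicit Types (x y z : S) (g h c d : perm_group S).

Definition pgen x : perm_group S := perm_proj (iota_sg x).

(* The left action of the permutation group through the sigma's and its right *)
(* action through the tau's.                                                  *)
Definition pact_sigma g x : S := (pg_val g).1 x.
Definition pact_tau g x : S := ((pg_val g).2 : {perm S})^-1%g x.

Lemma pact_sigmaM g h x : pact_sigma (g * h) x = pact_sigma g (pact_sigma h x).
Proof. by rewrite /pact_sigma /= permM. Qed.

Lemma pact_tauM g h x : pact_tau (g * h) x = pact_tau h (pact_tau g x).
Proof. by rewrite /pact_tau -permM -invgM. Qed.

Lemma pact_sigma1 x : pact_sigma 1 x = x.
Proof. by rewrite /pact_sigma /= perm1. Qed.

Lemma pact_tau1 x : pact_tau 1 x = x.
Proof. by rewrite /pact_tau /= invg1 perm1. Qed.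

Lemma pact_sigma_gen x y : pact_sigma (pgen x) y = sigma x y.
Proof. by rewrite /pact_sigma /= perm_hom_iota /= permE. Qed.

Lemma pact_tau_gen x y : pact_tau (pgen x) y = tau x y.
Proof. by rewrite /pact_tau /= perm_hom_iota /= invgK permE. Qed.

Lemma pact_inj g h :
  pact_sigma g =1 pact_sigma h -> pact_tau g =1 pact_tau h -> g = h.
Proof.
move=> h1 h2; apply: val_inj => /=.
rewrite (surjective_pairing (pg_val g)) (surjective_pairing (pg_val h)).
congr pair; first exact/permP.
by apply: (@invg_inj {perm S}); apply/permP.
Qed.

Lemma pgenM x y : pgen x * pgen y = pgen (sigma x y) * pgen (tau y x).
Proof. by rewrite /pgen -!perm_projM iota_sgM. Qed.

Lemma sb_lambda_pgen x y : sb_lambda P (pgen x) (pgen y) = pgen (sigma x y).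
Proof.
have [A hA pD] := HP.
by rewrite /pgen -hA (brace_morph_lambda (@perm_projM S) pD).
Qed.

Lemma sb_rho_pgen x y : sb_rho P (pgen y) (pgen x) = pgen (tau y x).
Proof. by rewrite /sb_rho sb_lambda_pgen pgenM mulKg. Qed.

Lemma pgen_eq_iret1 x y : pgen x = pgen y -> iret (@sigma S) (@tau S) 1 x y.
Proof.
by move=> e z /=; rewrite -!pact_sigma_gen -!pact_tau_gen e.
Qed.

Lemma perm_proj1 : perm_proj 1 = 1 :> perm_group S.
Proof. by apply: (mulgI (perm_proj 1)); rewrite -perm_projM !mulg1. Qed.

(* By finiteness the generators alone, without their inverses, suffice. *)
Lemma perm_group_ind (Q : perm_group S -> Prop) :
  Q 1 -> (forall x g, Q g -> Q (pgen x * g)) -> forall g, Q g.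
Proof.
move=> Q1 Qx g.
have [k <-] := perm_proj_surj g; rewrite -(wpiE k).
elim: (repr k) => [|[b x] u IH]; first by rewrite -perm_proj1 in Q1.
have -> : wpi ((b, x) :: u) = wpi [:: (b, x)] * wpi u.
  by rewrite /mul /= sg_mul_pi.
rewrite perm_projM; case: b; last exact: Qx.
have -> : perm_proj (wpi [:: (true, x)]) = (pgen x)^-1.
  apply: (mulgI (pgen x)); rewrite mulgV -perm_projM -perm_proj1.
  by congr perm_proj; rewrite /mul /= sg_mul_pi; apply/wpiP/weq_cancel.
have [n ->] := @invg_expg _ ({perm S} * {perm S})%type (@pg_val S) (pgen x) val_inj.
elim: n => [|n IHn]; first by rewrite expg0 mul1g.
by rewrite expgS -mulgA; apply: Qx.
Qed.

Lemma sb_lambda_pact g x : sb_lambda P g (pgen x) = pgen (pact_sigma g x).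
Proof.
elim/perm_group_ind: g x => [|y g IH] x; first by rewrite sb_lambda1 pact_sigma1.
by rewrite sb_lambdaM IH sb_lambda_pgen pact_sigmaM pact_sigma_gen.
Qed.

Lemma sb_rho_pact g x : sb_rho P g (pgen x) = pgen (pact_tau g x).
Proof.
elim/perm_group_ind: g x => [|y g IH] x; first by rewrite sb_rho1 pact_tau1.
by rewrite sb_rhoM sb_rho_pgen IH pact_tauM pact_tau_gen.
Qed.

(** * Agreement of actions on Ret^n *)

Local Notation R := (iret (@sigma S) (@tau S)).

(* g and h have the same image in the permutation group of Ret^n. *)
Definition pact_eq n g h := forall x,
  R n (pact_sigma g x) (pact_sigma h x) /\ R n (pact_tau g x) (pact_tau h x).

Lemma iret_pact n g x y : R n x y ->
  R n (pact_sigma g x) (pact_sigma g y) /\ R n (pact_tau g x) (pact_tau g y).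
Proof.
elim/perm_group_ind: g x y => [|w g IH] x y h.
  by rewrite !pact_sigma1 !pact_tau1.
have [_ h2] := iret_congr (iret_refl _ _ n w) h.
rewrite !pact_sigmaM !pact_tauM !pact_sigma_gen !pact_tau_gen.
split; last by have [] := IH _ _ h2.
have [h3 _] := IH _ _ h.
by have [] := iret_congr (iret_refl _ _ n w) h3.
Qed.

Lemma pact_eq_refl n g : pact_eq n g g.
Proof. by move=> x; split; apply: iret_refl. Qed.

Lemma pact_eq_sym n g h : pact_eq n g h -> pact_eq n h g.
Proof. by move=> e x; have [h1 h2] := e x; split; apply: iret_sym. Qed.

Lemma pact_eqM n g g' h h' :
  pact_eq n g g' -> pact_eq n h h' -> pact_eq n (g * h) (g' * h').
Proof.
move=> eg eh x; rewrite !pact_sigmaM !pact_tauM; split.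
  apply: (iret_trans (y := pact_sigma g (pact_sigma h' x))).
    by have [/(iret_pact g)[]] := eh x.
  by have [] := eg (pact_sigma h' x).
apply: (iret_trans (y := pact_tau h (pact_tau g' x))).
  by have [_ /(iret_pact h)[]] := eg x.
by have [] := eh (pact_tau g' x).
Qed.

Lemma pact_eqV n g h : pact_eq n g h -> pact_eq n g^-1 h^-1.
Proof.
move=> /pact_eq_sym e.
have := pact_eqM (pact_eqM (pact_eq_refl n g^-1) e) (pact_eq_refl n h^-1).
by rewrite mulgK mulVg mul1g.
Qed.

(** The one place where a level is spent; products, inverses and actions on a fixed level preserve
    it. *)
Lemma pact_eq_pgen n x y : R n.+1 x y -> pact_eq n (pgen x) (pgen y).
Proof.
by move=> h z; rewrite !pact_sigma_gen !pact_tau_gen; apply: h.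
Qed.

Lemma pact_eq_pgen_same n x y : R n x y -> pact_eq n (pgen x) (pgen y).
Proof.
move=> h z; rewrite !pact_sigma_gen !pact_tau_gen.
exact: iret_congr h (iret_refl _ _ n z).
Qed.

Lemma pact_eq_rho_pgen n g h x : pact_eq n g h ->
  pact_eq n (sb_rho P (pgen x) g) (sb_rho P (pgen x) h).
Proof.
move=> e; rewrite /sb_rho !sb_lambda_pact; apply: pact_eqM.
  by apply/pact_eqV/pact_eq_pgen_same; have [] := e x.
exact: pact_eqM e (pact_eq_refl n _).
Qed.

Lemma pact_eq_lambda_pgen n g h x : pact_eq n g h ->
  pact_eq n (sb_lambda P (pgen x) g) (sb_lambda P (pgen x) h).
Proof.
(* Solving a o b = lambda_a(b) o rho_b(a) for lambda leaves only products, inverses and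
   generators. *)
have lamE k : sb_lambda P (pgen x) k = pgen x * k * (pgen (pact_tau k x))^-1.
  by rewrite -sb_rho_pact -[pgen x * k](sb_lambda_rho P) mulgK.
move=> e; rewrite !lamE; apply: pact_eqM.
  exact: pact_eqM (pact_eq_refl n _) e.
by apply/pact_eqV/pact_eq_pgen_same; have [] := e x.
Qed.

(* Acting on a single generator gains one retraction level; the cocycle       *)
(* formulas for lambda and rho spread this over products.                     *)
Lemma pact_eq_lambda n g h c : pact_eq n.+1 g h ->
  pact_eq n (sb_lambda P g c) (sb_lambda P h c).
Proof.
elim/perm_group_ind: c g h => [|x c IH] g h e.
  by rewrite -(sb_zero1 P) !sb_lambda0; apply: pact_eq_refl.
rewrite !sb_lambda_mulr; apply: pact_eqM; last exact/IH/pact_eq_rho_pgen.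
by rewrite !sb_lambda_pact; apply: pact_eq_pgen; have [] := e x.
Qed.

Lemma sb_rho_r1 g : sb_rho P g 1 = 1.
Proof. by rewrite /sb_rho sb_lambda1 mul1g mulVg. Qed.

Lemma pact_eq_lambda_same n g h c :
  pact_eq n g h -> pact_eq n (sb_lambda P c g) (sb_lambda P c h).
Proof.
elim/perm_group_ind: c g h => [|x c IH] g h e; first by rewrite !sb_lambda1.
by rewrite !sb_lambdaM; apply/pact_eq_lambda_pgen/IH.
Qed.

Lemma pact_eq_rho n g h c : pact_eq n.+1 g h ->
  pact_eq n (sb_rho P g c) (sb_rho P h c).
Proof.
elim/perm_group_ind: c g h => [|x c IH] g h e.
  by rewrite !sb_rho_r1; apply: pact_eq_refl.
(* In the first factor [g] and [h] become their images under lambda by [c], which still agree at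
   level [n.+1]; the level drops only on passing to [pgen]. *)
rewrite !sb_rho_mulr; apply: pact_eqM; last exact: IH.
rewrite !sb_rho_pact; apply: pact_eq_pgen.
by have [] := pact_eq_lambda_same c e x.
Qed.

Lemma pact_eq_iret n g h : pact_eq n g h -> iret (sb_lambda P) (sb_rho P) n g h.
Proof.
(* At level 0 the actions are equal, and they determine the element. *)
elim: n g h => [|n IH] g h e; first by apply: pact_inj => x; have [] := e x.
by move=> c; split; apply: IH; [apply: pact_eq_lambda|apply: pact_eq_rho].
Qed.

Lemma permutation_brace_mp : iret_trivial (@sigma S) (@tau S) <-> brace_mp P.
Proof.
split=> [[n hn]|].
  (* When level [n] identifies all points, any two elements act alike. *)
  by exists n => g h; apply: pact_eq_iret => x; split; apply: hn.
apply: (iret_trivial_ker (f := pgen) _ _ pgen_eq_iret1) => x y.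
  by rewrite sb_lambda_pgen.
by rewrite sb_rho_pgen.
Qed.

End PermutationBrace.

Theorem theorem4p3 (S T : nd_solution) :
  (0 < #|S|)%N -> (0 < #|T|)%N -> permutation_isoclinic S T ->
  (multipermutation S <-> multipermutation T).
Proof.
move=> S0 T0 [P [Q [hP hQ /isoclinic_brace_mp PQ]]].
rewrite (multipermutationP S0) (multipermutationP T0).
by rewrite (permutation_brace_mp hP) (permutation_brace_mp hQ).
Qed.
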